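(* Let $(X,\mathcal{X})$ be a measurable space, let $\Theta$ be a nonempty open interval of $\mathbb{R}$, let $n\in\mathbb{N}$, $\psi\in\Psi[Z_n](X,\Theta)$, and suppose that $\psi$ is measurable in its first variable, i.e., for each $t\in\Theta$ the map $X\ni x\mapsto\psi(x,t)$ is measurable with respect to $\mathcal{X}$. Then $\vartheta_{n,\psi}:X^n\to\Theta$ is measurable with respect to the sigma-algebras $\mathcal{X}^n$ and $\mathcal{B}(\Theta)$.
   Context: $\mathbb{N}$ is the set of positive integers. $\mathcal{X}^n$ is the product sigma-algebra on $X^n$ and $\mathcal{B}(\Theta)$ is the Borel sigma-algebra on $\Theta$. Point of sign change: for $f:\Theta\to\mathbb{R}$, an element $\vartheta\in\Theta$ is a point of sign change (of decreasing type) for $f$ if $f(t)>0$ for all $t\in\Theta$ with $t<\vartheta$ and $f(t)<0$ for all $t\in\Theta$ with $t>\vartheta$. $\Psi(X,\Theta)$ is the class of functions $\psi:X\times\Theta\to\mathbb{R}$ such that for each $x\in X$ there exist $t_+,t_-\in\Theta$ with $t_+<t_-$ and $\psi(x,t_+)>0>\psi(x,t_-)$. $\psi\in\Psi[Z_n](X,\Theta)$ means that $\psi\in\Psi(X,\Theta)$, that for every $(x_1,\ldots,x_n)\in X^n$ the function $\Theta\ni t\mapsto\sum_{i=1}^n\psi(x_i,t)$ has a (necessarily unique) point of sign change $\vartheta_{n,\psi}(x_1,\ldots,x_n)\in\Theta$, and that $\sum_{i=1}^n\psi(x_i,\vartheta_{n,\psi}(x_1,\ldots,x_n))=0$ for all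 $(x_1,\ldots,x_n)\in X^n$. *)

(* Defs.v *)
From HB Require Import structures.
From mathcomp Require Import all_boot all_order all_algebra.
From mathcomp Require Import all_classical all_reals all_analysis.
Import Order.TTheory GRing.Theory Num.Theory.
Import numFieldNormedType.Exports.

Set Implicit Arguments.
Unset Strict Implicit.
Unset Printing Implicit Defensive.

Local Open Scope classical_set_scope.
Local Open Scope ring_scope.

(* A subset Theta of R is used as a type through the coercion [set_type];
   [val : Theta -> R] is the inclusion. *)

Section PsiClasses.
Context {R : realType} {X : Type} {Theta : set R}.

Definition sign_change (f : Theta -> R) (v : Theta) : Prop :=
  (forall t : Theta, val t < val v -> 0 < f t) /\
  (forall t : Theta, val v < val t -> f t < 0).

Lemma sign_change_unique (f : Theta -> R) (u v : Theta) :
  is_interval Theta -> sign_change f u -> sign_change f v -> u = v.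
Proof.
move=> iT.
have main (a b : Theta) : sign_change f a -> sign_change f b ->
    ~ (val a < val b).
  move=> [_ fa] [fb _] ab.
  have [am mb] := midf_lt ab.
  have Tm : Theta ((val a + val b) / 2).
    by apply: (iT (val a) (val b)); [exact: set_valP|exact: set_valP|
      rewrite (ltW am) (ltW mb)].
  pose m : Theta := SigSub (mem_set Tm).
  by have := lt_trans (fa m am) (fb m mb); rewrite ltxx.
move=> fu fv; apply: val_inj.
by case: (ltgtP (val u) (val v)) => // /main; [case/(_ fu fv)|case/(_ fv fu)].
Qed.

Definition Psi (psi : X -> Theta -> R) : Prop :=
  forall x : X, exists tp tm : Theta,
    [/\ val tp < val tm, 0 < psi x tp & psi x tm < 0].

Definition psi_sum (psi : X -> Theta -> R) (n : nat) (xs : n.-tuple X)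
  (t : Theta) : R := \sum_(i < n) psi (tnth xs i) t.

(* By [sign_change_unique], the quantification over [v] in the last field
   ranges over the unique point of sign change. *)
Record PsiZ (n : nat) (psi : X -> Theta -> R) : Prop := {
  PsiZ_Psi : Psi psi ;
  PsiZ_sign_change : forall xs : n.-tuple X,
    exists v : Theta, sign_change (psi_sum psi xs) v ;
  PsiZ_zero : forall (xs : n.-tuple X) (v : Theta),
    sign_change (psi_sum psi xs) v -> psi_sum psi xs v = 0 }.

Definition vartheta (n : nat) (psi : X -> Theta -> R) (hpsi : PsiZ n psi)
  (xs : n.-tuple X) : Theta := sval (cid (PsiZ_sign_change hpsi xs)).

Lemma varthetaP (n : nat) (psi : X -> Theta -> R) (hpsi : PsiZ n psi)
  (xs : n.-tuple X) : sign_change (psi_sum psi xs) (vartheta hpsi xs).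
Proof. exact: (svalP (cid (PsiZ_sign_change hpsi xs))). Qed.

End PsiClasses.

(* [open] refers to the subspace topology carried by [set_type Theta].
   This is a bare set system: making [Theta] a [measurableType] would require
   a distinguished point. *)
Definition Borel {R : realType} (Theta : set R) : set (set Theta) :=
  <<s [set U : set Theta | open U] >>.

(* Main.v *)
Require Import Defs.
From HB Require Import structures.
From mathcomp Require Import all_boot all_order all_algebra.
From mathcomp Require Import all_classical all_reals all_analysis.
From mathcomp Require Import measurable_realfun.
Import Order.TTheory GRing.Theory Num.Theory.
Import numFieldNormedType.Exports.

Set Implicit Arguments.
Unset Strict Implicit.
Unset Printing Implicit Defensive.

Local Open Scope classical_set_scope.
Local Open Scope ring_scope.

(** Write [S xs t] for the sum of the [psi (x_i, t)].  The sign of [S xs] is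
positive to the left of its point of sign change, zero at it, and negative to
the right of it; hence [t] lies strictly to the left of [vartheta xs] exactly
when [0 < S xs t] ([lt_varthetaE]).  For a fixed [t] in [Theta] the right-hand
side is a measurable condition on [xs], because [S] is a finite sum of
measurable functions of the coordinates.  So the preimages under [vartheta] of
the rays with endpoint in [Theta] are measurable.  A ray of the real line
whose endpoint is outside the interval [Theta] contains all or none of [Theta]
([measurable_fun_val_rays]), and the rays generate the Borel sets; what remains
is to pass from the Borel sets of the line to those of the subspace [Theta]
([measurable_preimage_Borel]). *)

(** The subsets of [Theta] with measurable preimage form a sigma-algebra, so
only the open sets matter, and these are traces of open sets of the line. *)
Lemma measurable_preimage_Borel (R : realType) (Theta : set R)
    (d : measure_display) (T : measurableType d) (f : T -> Theta) :
  measurable_fun [set: T] (fun x => val (f x)) ->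
  forall B : set Theta, Borel B -> measurable (f @^-1` B).
Proof.
move=> mf B BB; rewrite -[f @^-1` B]setTI; move: B BB.
apply: (@smallest_sub _ _ _ (image_set_system setT f measurable)).
  exact/sigma_algebra_image/sigma_algebra_measurable.
move=> _ [V oV <-].
exact: (mf measurableT V (open_measurable oV)).
Qed.

(** An endpoint outside the interval [Theta] has all of [Theta] on one side, so
its ray pulls back to the empty set or to the whole space. *)
Lemma measurable_fun_val_rays (R : realType) (Theta : set R)
    (d : measure_display) (T : measurableType d) (f : T -> Theta) :
  is_interval Theta ->
  (forall t : Theta, measurable [set x | val t < val (f x)]) ->
  measurable_fun [set: T] (fun x => val (f x)).
Proof.
move=> iT mray; apply: (measurability _ (RGenOInfty.measurableE R)).
move=> _ [_ [a ->] <-]; rewrite setTI preimage_itvoy.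
have [Ta|nTa] := pselect (Theta a).
  exact: (mray (SigSub (mem_set Ta))).
have [[y ay]|none] := pselect (exists y, a < val (f y)).
  suff -> : [set x | a < val (f x)] = setT by exact: measurableT.
  apply/seteqP; split=> // x _ /=; rewrite ltNge; apply/negP => xa.
  apply: nTa; apply: (iT (val (f x)) (val (f y))); try exact: set_valP.
  by rewrite xa ltW.
suff -> : [set x | a < val (f x)] = set0 by exact: measurable0.
by apply/seteqP; split=> // x ax; apply: none; exists x.
Qed.

(** The vanishing of the sum at [vartheta] is what rules out a positive value
at that point. *)
Lemma lt_varthetaE (R : realType) (X : Type) (Theta : set R) (n : nat)
    (psi : X -> Theta -> R) (hpsi : PsiZ n psi) (xs : n.-tuple X) (t : Theta) :
  (val t < val (vartheta hpsi xs)) = (0 < psi_sum psi xs t).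
Proof.
have v_change := varthetaP hpsi xs; have [pos neg] := v_change.
case: ltgtP => [/pos -> //|/neg|/val_inj ->].
  by move=> S_lt0; rewrite ltNge ltW.
by rewrite (PsiZ_zero hpsi v_change) ltxx.
Qed.

Lemma measurable_psi_sum (R : realType) (d : measure_display)
    (X : measurableType d) (Theta : set R) (n : nat) (psi : X -> Theta -> R)
    (t : Theta) :
  measurable_fun [set: X] (fun x => psi x t) ->
  measurable_fun [set: n.-tuple X] (fun xs => psi_sum psi xs t).
Proof.
move=> mpsi; apply: measurable_sum => i.
exact: (measurableT_comp mpsi (measurable_tnth i)).
Qed.

Theorem proposition2p4 (R : realType) (d : measure_display)
  (X : measurableType d) (Theta : set R)
  (Theta_nonempty : Theta !=set0) (Theta_open : open Theta)
  (Theta_interval : is_interval Theta)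
  (n : nat) (n_gt0 : (0 < n)%N)
  (psi : X -> Theta -> R) (hpsi : PsiZ n psi)
  (psi_measurable : forall t : Theta,
    measurable_fun [set: X] (fun x : X => psi x t)) :
  forall B : set Theta, Borel B ->
    measurable (vartheta hpsi @^-1` B : set (n.-tuple X)).
Proof.
apply: measurable_preimage_Borel; apply: measurable_fun_val_rays => // t.
under eq_set do rewrite lt_varthetaE.
have := measurable_psi_sum (n := n) (psi_measurable t).
move=> /(_ measurableT `]0, +oo[%classic (measurable_itv _)).
by rewrite setTI preimage_itvoy.
Qed.
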